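(* Let $g:\mathbb{R}\to\mathbb{R}$ be a Tauber-Wiener function. Let $K_1'$ and $K_2'$ be Banach spaces, let $K_1\subset K_1'$ and $K_2\subset K_2'$ be compact, and let $V_1\subset C(K_1)$ and $V_2\subset C(K_2)$ be compact; put $V=V_1\cup V_2$. Let $K_x\subset\mathbb{R}^d$ be compact. Let $G_1:V_1\to U$, $G_2:V_2\to U$ and $G:V\to U$ be continuous (possibly nonlinear) operators such that $G(u)=G_1(u)$ for all $u\in V_1$, $G(u)=G_2(u)$ for all $u\in V_2$, and $U=G_1(V_1)\cup G_2(V_2)\subset C(K_x)$. Then for every $\varepsilon>0$ there exist positive integers $K,I_1,I_2,N_1,N_2$, real weights $c^1_{i,k}$ ($1\le i\le I_1$, $1\le k\le K$) and $c^2_{i,k}$ ($1\le i\le I_2$, $1\le k\le K$), points $y_1,\dots,y_{N_1}\in K_1$ and $z_1,\dots,z_{N_2}\in K_2$, functions $b^1_{i,k}:\mathbb{R}^{N_1}\to\mathbb{R}$ and $b^2_{i,k}:\mathbb{R}^{N_2}\to\mathbb{R}$ of the form $$b^1_{i,k}(\xi)=g(w^1_{i,k}\cdot\xi+p^1_{i,k}),\qquad b^2_{i,k}(\xi)=g(w^2_{i,k}\cdot\xi+p^2_{i,k}),$$ with $w^1_{i,k}\in\mathbb{R}^{N_1}$, $w^2_{i,k}\in\mathbb{R}^{N_2}$, $p^1_{i,k},p^2_{i,k}\in\mathbb{R}$, and functions $\tau_k:K_x\to\mathbb{R}$ ($1\le k\le K$) of the form $\tau_k(x)=g(w_k\cdot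 x+p_k)$ with $w_k\in\mathbb{R}^d$, $p_k\in\mathbb{R}$ (the same functions $\tau_k$ being used for both operators), such that $$\Big|G_1(u_1)(x)-\sum_{k=1}^{K}\sum_{i=1}^{I_1}c^1_{i,k}\,b^1_{i,k}(\hat u_1)\,\tau_k(x)\Big|<\varepsilon,$$ $$\Big|G_2(u_2)(x)-\sum_{k=1}^{K}\sum_{i=1}^{I_2}c^2_{i,k}\,b^2_{i,k}(\hat u_2)\,\tau_k(x)\Big|<\varepsilon$$ for all $u_1\in V_1$, $u_2\in V_2$ and $x\in K_x$, where $\hat u_1=[u_1(y_1),\dots,u_1(y_{N_1})]^\top\in\mathbb{R}^{N_1}$ and $\hat u_2=[u_2(z_1),\dots,u_2(z_{N_2})]^\top\in\mathbb{R}^{N_2}$.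
   Context: For a compact set $K$, $C(K)$ denotes the space of continuous real-valued functions on $K$ with the supremum norm; compactness of $V_1,V_2$ and continuity of $G_1,G_2$ are with respect to these norms (on $C(K_1)$, $C(K_2)$ and $C(K_x)$). The set $V=V_1\cup V_2$ carries the topology in which a subset is open iff its intersection with each $V_j$ is open in $V_j$ ($j=1,2$); this is the subspace topology of $C(K_1)$ when $K_1=K_2$ and the disjoint union topology when $K_1\ne K_2$. Thus continuity of $G$ is equivalent to continuity of both $G_1$ and $G_2$. A function $g:\mathbb{R}\to\mathbb{R}$ (continuous or discontinuous) is called a Tauber-Wiener function if for every $a<b$ the set of all finite linear combinations $\sum_{i=1}^{N}c_i\,g(\lambda_i x+\theta_i)$, with $c_i,\lambda_i,\theta_i\in\mathbb{R}$, is dense in $C[a,b]$ in the supremum norm, i.e. for every $f\in C[a,b]$ and $\delta>0$ some such combination differs from $f$ by less than $\delta$ at every point of $[a,b]$. *)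

(* Defs.v *)
From HB Require Import structures.
From mathcomp Require Import all_boot all_order all_algebra.
From mathcomp Require Import generic_quotient.
From mathcomp Require Import all_classical all_reals all_analysis.

Set Implicit Arguments.
Unset Strict Implicit.
Unset Printing Implicit Defensive.

Import Order.TTheory GRing.Theory Num.Theory.
Import numFieldNormedType.Exports.
Local Open Scope classical_set_scope.
Local Open Scope ring_scope.

Section ContinuousFunctions.
Context {R : realType} {T : topologicalType}.

(* The topology of uniform convergence on the continuous functions K -> R;
   [nbhs_Cspace] below identifies it with the sup-norm topology when K is
   compact. *)
Definition uniform_incl (K : set T) (f : continuousType K R) :
  arrow_uniform_type K R := f.

Definition Cspace (K : set T) : Type := initial_topology (@uniform_incl K).

HB.instance Definition _ (K : set T) := PseudoMetric.on (Cspace K).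

Definition Cspace_fun (K : set T) (f : Cspace K) : K -> R :=
  (f : continuousType K R).

Coercion Cspace_fun : Cspace >-> Funclass.

Definition supdist (K : set T) (f g : Cspace K) : R :=
  sup (range (fun x : K => `|f x - g x|)).

Lemma Cspace_ballE (K : set T) (f g : Cspace K) (e : R) :
  ball f e g <-> forall x : K, `|f x - g x| < e.
Proof. by split. Qed.

Lemma Cspace_continuous (K : set T) (f : Cspace K) : continuous (f : K -> R).
Proof. exact: (@cts_fun _ _ (f : continuousType K R)). Qed.

Lemma supdist_ub (K : set T) (f g : Cspace K) (x : K) :
  compact K -> `|f x - g x| <= supdist f g.
Proof.
move=> cK; apply: ub_le_sup; last by exists x.
pose h (x : K) : R := `|f x - g x|.
have ch : continuous h.
  move=> y; apply: (@cvg_norm _ R^o _ (nbhs y) _ (fun z => f z - g z)).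
  by apply: (@cvgB _ R^o); exact: Cspace_continuous.
have /compact_bounded[M [_ bM]] :=
  continuous_compact ((subspace_valL_continuousP K h).2 ch) cK.
exists (M + 1) => _ [y _ <-].
have /(bM (M + 1)) : M < M + 1 by rewrite ltrDl.
move=> /(_ (h y)) /=; rewrite (ger0_norm (normr_ge0 _)); apply.
by exists (val y); [exact/set_mem/valP | rewrite -[in RHS](valLK point h)].
Qed.

Lemma nbhs_Cspace (K : set T) (f : Cspace K) (A : set (Cspace K)) : compact K ->
  nbhs f A <-> exists2 e : R, 0 < e & [set g | supdist f g < e] `<=` A.
Proof.
move=> cK; split=> [/nbhs_ballP[e /= e0 eA]|[e e0 eA]].
  exists e => // g /= fg; apply: eA; apply/Cspace_ballE => x.
  exact: le_lt_trans (supdist_ub f g x cK) fg.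
apply/nbhs_ballP; exists (e / 2) => /=; first by rewrite divr_gt0.
move=> g /Cspace_ballE fg; apply: eA => /=.
have [x|K0] := pselect (exists x : K, True).
- apply: (@le_lt_trans _ _ (e / 2)); last by rewrite ltr_pdivrMr // ltr_pMr // ltr1n.
  apply: ge_sup; first by case: x => x _; exists `|f x - g x|; exists x.
  by move=> _ [y _ <-]; apply/ltW/fg.
- suff -> : supdist f g = 0 by [].
  rewrite /supdist -[RHS](@sup0 R); congr sup.
  by rewrite -subset0 => r [y _ _]; case: K0; exists y.
Qed.

End ContinuousFunctions.
Arguments Cspace R {T} K.

Section PartialFunctions.
Context {R : realType}.

(* Real functions together with their domain, so that u1 : C(K1) and
   u2 : C(K2) are equal as elements of [pfun] only if K1 and K2 are the same
   set and u1, u2 take the same values. *)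
Definition pfun : Type := {T : Type & {K : set T & K -> R}}.

Definition to_pfun (T : topologicalType) (K : set T) (f : Cspace R K) : pfun :=
  existT _ (T : Type) (existT _ K (f : K -> R)).

Lemma existT_injr (X : Type) (P : X -> Type) (x : X) (a b : P x) :
  existT P x a = existT P x b -> a = b.
Proof.
have castE (p q : {y & P y}) (e : p = q) :
  eq_rect _ P (projT2 p) _ (f_equal (@projT1 X P) e) = projT2 q by case: q / e.
move=> h; move: (f_equal _ h) (castE _ _ h) => /= e.
by rewrite (Prop_irrelevance e erefl).
Qed.

Lemma to_pfun_inj (T : topologicalType) (K : set T) :
  injective (@to_pfun T K).
Proof.
move=> f g fg; have {}fg := existT_injr (existT_injr fg).
apply/continuousEP => x.
exact: (f_equal (fun h : K -> R => h x) fg).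
Qed.
End PartialFunctions.
Arguments pfun R : clear implicits.

Section Union.
Context {R : realType} {T1 T2 : topologicalType} {K1 : set T1} {K2 : set T2}.
Variables (V1 : set (Cspace R K1)) (V2 : set (Cspace R K2)).

(* V1 `|` V2 as a quotient of the disjoint union, since subsets of [pfun] are
   too large to carry a topology. *)
Definition sum_pfun (u : V1 + V2) : pfun R :=
  match u with inl u1 => to_pfun (val u1) | inr u2 => to_pfun (val u2) end.

Definition same_fun (u v : V1 + V2) : bool := `[< sum_pfun u = sum_pfun v >].

Lemma same_fun_refl : reflexive same_fun.
Proof. by move=> u; apply/asboolP. Qed.

Lemma same_fun_sym : symmetric same_fun.
Proof. by move=> u v; apply/asboolP/asboolP => ->. Qed.

Lemma same_fun_trans : transitive same_fun.
Proof.
by move=> v u w /asboolP uv /asboolP vw; apply/asboolP; rewrite uv.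
Qed.

Definition same_fun_equiv :=
  EquivRel _ same_fun_refl same_fun_sym same_fun_trans.

Definition unionV : Type := {eq_quot same_fun_equiv}%qT.

Definition inV1 (u : V1) : unionV := (\pi_{eq_quot same_fun_equiv} (inl u))%qT.
Definition inV2 (u : V2) : unionV := (\pi_{eq_quot same_fun_equiv} (inr u))%qT.

Lemma inV_eqP (u1 : V1) (u2 : V2) :
  inV1 u1 = inV2 u2 <-> to_pfun (val u1) = to_pfun (val u2).
Proof. by split=> [/eqmodP/asboolP //|h]; apply/eqmodP/asboolP. Qed.

Definition unionV_open (A : set unionV) : Prop :=
  open (inV1 @^-1` A) /\ open (inV2 @^-1` A).

Lemma unionV_openT : unionV_open setT.
Proof. by rewrite /unionV_open !preimage_setT; split; exact: openT. Qed.

Lemma unionV_openI : setI_closed unionV_open.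
Proof.
move=> A B [A1 A2] [B1 B2]; rewrite /unionV_open !preimage_setI.
by split; exact: openI.
Qed.

Lemma unionV_open_bigU (I : Type) (f : I -> set unionV) :
  (forall i, unionV_open (f i)) -> unionV_open (\bigcup_i f i).
Proof.
move=> fo; rewrite /unionV_open !preimage_bigcup.
by split; apply: bigcup_open => i _; have [] := fo i.
Qed.

HB.instance Definition _ := Choice.on unionV.
HB.instance Definition _ :=
  isOpenTopological.Build unionV unionV_openT unionV_openI unionV_open_bigU.

End Union.
Arguments inV1 {R T1 T2 K1 K2 V1} V2 u.
Arguments inV2 {R T1 T2 K1 K2} V1 {V2} u.

Section TauberWiener.
Context {R : realType}.

(* The density is stated pointwise rather than in [Cspace]: g, hence the
   approximating combinations, may be discontinuous. *)
Definition TauberWiener (g : R -> R) : Prop :=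
  forall a b : R, a < b ->
  forall f : R -> R, {within `[a, b], continuous f} ->
  forall delta : R, 0 < delta ->
  exists (N : nat) (c lambda theta : 'I_N -> R),
    forall x, a <= x <= b ->
      `|f x - \sum_(i < N) c i * g (lambda i * x + theta i)| < delta.

Definition dot (n : nat) (w x : 'rV[R]_n) : R := \sum_(j < n) w 0 j * x 0 j.

End TauberWiener.

(* Main.v *)
(* Evaluate the operators: F(u,x) = G(u)(x) is continuous on the compact space
   V * Kx. There, finite sums of products exp(L(u)) exp(M(x)), with L a linear
   combination of point evaluations u(y_j) and M a linear form in x, form an
   algebra (exp turns sums into products) that separates points, so they are
   dense by Stone-Weierstrass. Both L and M have values in some [-B, B], and
   replacing the scalar function exp on this interval by a combination of
   translates and dilates of g gives sums of products g(lambda L(u) + theta)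
   g(lambda' M(x) + theta'). *)

Require Import Defs.
From mathcomp Require Import all_boot all_order all_algebra.
From mathcomp Require Import all_classical all_reals all_analysis.
From mathcomp Require Import ring lra.
Import Order.TTheory GRing.Theory Num.Theory.
Import numFieldNormedType.Exports.
Local Open Scope classical_set_scope.
Local Open Scope ring_scope.

(** Finitely many of the given neighbourhoods cover the space, and their union is again in [P]. This
    takes the place of the two extractions of a finite subcover in [stone_weierstrass]. *)
Lemma compact_ind (X : topologicalType) (P : set (set X)) :
  compact [set: X] -> P set0 ->
  (forall A B, P A -> P B -> P (A `|` B)) ->
  (forall x : X, exists2 N, nbhs x N & P N) ->
  P setT.
Proof.
move=> /compact_near_coveringP cX P0 PU Ploc.
(* Near covering is applied to the filter of tails of P ordered by inclusion. *)
pose F : set_system (set X) :=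
  [set Q | exists2 A, P A & forall B, P B -> A `<=` B -> Q B].
have FF : Filter F.
  split.
  - by exists set0.
  - move=> Q1 Q2 [A1 PA1 h1] [A2 PA2 h2].
    exists (A1 `|` A2); first exact: PU.
    by move=> B PB; rewrite subUset => -[AB1 AB2]; split; [exact: h1|exact: h2].
  - move=> Q1 Q2 Q12 [A PA h]; exists A => // B PB AB.
    by apply: Q12; exact: h.
have [|A PA /(_ A PA)] := cX _ F (fun A x => A x) FF.
  move=> x _; have [N xN PN] := Ploc x.
  exists (N, [set B | N `<=` B]) => /=; first by split=> //; exists N.
  by move=> [y B] /= [Ny NB]; exact: NB.
by move=> h; have <- : A = setT by rewrite eqEsubset; split=> // x _; exact: h.
Qed.

(** * The Stone-Weierstrass theorem on a compact space *)

Section StoneWeierstrass.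
Context {R : realType}.

(* On [-1, 1] these polynomials in t increase to |t|. *)
Fixpoint abs_iter (t : R) (n : nat) : R :=
  if n is m.+1 then abs_iter t m + (t ^+ 2 - abs_iter t m ^+ 2) / 2 else 0.

(** With [s = |t|], an iterate [q] and its successor [q'] satisfy
    [s - q' = (s - q) (1 - (s + q) / 2)]. The last factor is nonnegative, so the iterates stay below
    [s]. Since [q >= 0], an error [x] becomes at most [x (1 - x / 2)], which forces decay of order
    [1 / n]. *)
Lemma abs_iter_bounds (t : R) n : `|t| <= 1 ->
  0 <= abs_iter t n <= `|t| /\ (n.+2)%:R * (`|t| - abs_iter t n) <= 2.
Proof.
move=> t1; have t0 := normr_ge0 t.
elim: n => [|n [/andP[q0 qt] ih]] /=.
  by rewrite lexx t0 subr0; split=> //; lra.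
rewrite -(real_normK (num_real t)).
move: (abs_iter t n) (`|t|) t0 t1 q0 qt ih => q s s0 s1 q0 qs ih.
have e1 : s - (q + (s ^+ 2 - q ^+ 2) / 2) = (s - q) * (1 - (s + q) / 2) by field.
split; first by apply/andP; split; nra.
rewrite e1 -[n.+3]addn1 natrD.
move: (n.+2)%:R (ler0n R n.+2) ih => m m0 ih.
have : (s - q) * (1 - (s + q) / 2) <= (s - q) * (1 - (s - q) / 2) by nra.
have : 0 <= s - q <= 1 by apply/andP; split; lra.
move: (s - q) ih => x ih /andP[x0 x1] h.
apply: (@le_trans _ _ ((m + 1) * (x * (1 - x / 2)))).
  by rewrite ler_wpM2l // addr_ge0.
rewrite -subr_ge0.
(* All three summands on the right are nonnegative, by [m * x <= 2] and [0 <= x <= 1]. *)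
have -> : 2 - (m + 1) * (x * (1 - x / 2)) =
  (2 - m * x) * (1 - x) + x * (2 - m * x) / 2 + x ^+ 2 / 2 by field.
rewrite !addr_ge0 // ?divr_ge0 ?mulr_ge0 ?sqr_ge0 //; lra.
Qed.

Context {X : topologicalType} (cX : compact [set: X]).

Lemma compact_fun_bounded (f : X -> R) : continuous f ->
  exists2 M : R, 0 < M & forall x, `|f x| <= M.
Proof.
move=> cf.
have /compact_bounded[M [_ bM]] : compact (range f).
  by apply: continuous_compact => //; exact: continuous_subspaceT.
exists (`|M| + 1); first by rewrite ltr_pwDr.
move=> x; apply: bM; last by exists x.
by rewrite (le_lt_trans (ler_norm M)) // ltrDl.
Qed.

Variable A : set (X -> R).
Hypothesis A_continuous : forall f, A f -> continuous f.
Hypothesis A_cst : forall c : R, A (fun=> c).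
Hypothesis A_add : forall f g, A f -> A g -> A (fun x => f x + g x).
Hypothesis A_mul : forall f g, A f -> A g -> A (fun x => f x * g x).
Hypothesis A_sep : forall x y, x <> y -> exists2 f, A f & f x <> f y.

Definition uniform_closure : set (X -> R) := [set f |
  forall e : R, 0 < e -> exists2 h, A h & forall x, `|f x - h x| < e].

(** An approximant [h] in [A] is scaled into [[-1, 1]] by a bound [M]. The iterates of [abs_iter]
    are polynomials in [h / M], so they stay in the algebra [A] and converge uniformly to
    [|h / M|]. *)
Lemma uniform_closure_norm f : uniform_closure f ->
  uniform_closure (fun x => `|f x|).
Proof.
move=> Af e e0; have [h Ah fh] := Af _ (divr_gt0 e0 (@ltr0n R 2)).
have [M M0 hM] := compact_fun_bounded _ (A_continuous _ Ah).
pose q n x := M * abs_iter (h x / M) n.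
have Aq n : A (q n).
  apply: A_mul => //; elim: n => [|n ihn] /=; first exact: A_cst.
  have Aopp k : A k -> A (fun x => - k x).
    by move=> Ak; under eq_fun do rewrite -mulN1r; exact: A_mul.
  apply: A_add => //; apply: (A_mul _ (fun=> 2^-1)) => //; apply: A_add.
    by apply: A_mul; exact: A_mul.
  by apply: Aopp; apply: A_mul.
(* The scaled iterate is off by at most [2 * M / n], which is below [e / 2] for such [n]. *)
have [n n0 nM] : exists2 n : nat, (0 < n)%N & 4 * M / e < n%:R.
  exists (Num.truncn (4 * M / e)).+1 => //; exact: truncnS_gt.
exists (q n) => // x.
have hM1 : `|h x / M| <= 1.
  by rewrite normrM normfV (gtr0_norm M0) ler_pdivrMr // mul1r.
have [/andP[q0 qs] qn] := abs_iter_bounds (h x / M) n hM1.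
have hE : `|h x| = M * `|h x / M|.
  by rewrite normrM normfV (gtr0_norm M0) mulrCA divff ?mulr1 ?gt_eqF.
have : `| `|h x| - q n x| < e / 2.
  rewrite hE -mulrBr normrM (gtr0_norm M0) ger0_norm ?subr_ge0 //.
  have h3 : n%:R * (`|h x / M| - abs_iter (h x / M) n) <= 2.
    by rewrite (le_trans _ qn) // ler_wpM2r ?subr_ge0 // ler_nat -addn2 leq_addr.
  have N0 : (0 : R) < n%:R by rewrite ltr0n.
  rewrite -(ltr_pM2l N0) mulrCA (@le_lt_trans _ _ (M * 2)) ?ler_pM2l //.
  by move: nM; rewrite ltr_pdivrMr //; lra.
have := ler_dist_dist (f x) (h x); have := fh x.
have := ler_normD (`|f x| - `|h x|) (`|h x| - q n x).
rewrite addrA subrK; lra.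
Qed.

Lemma uniform_closureD f g : uniform_closure f -> uniform_closure g ->
  uniform_closure (fun x => f x + g x).
Proof.
move=> Af Ag e e0; have e20 := divr_gt0 e0 (@ltr0n R 2).
have [h Ah fh] := Af _ e20; have [k Ak gk] := Ag _ e20.
exists (fun x => h x + k x); first exact: A_add.
move=> x; rewrite [e]splitr opprD addrACA.
by rewrite (le_lt_trans (ler_normD _ _)) // ltrD.
Qed.

Lemma uniform_closureZ c f : uniform_closure f ->
  uniform_closure (fun x => c * f x).
Proof.
move=> Af e e0; have c0 : 0 < `|c| + 1 by rewrite ltr_wpDl.
have [h Ah fh] := Af _ (divr_gt0 e0 c0).
exists (fun x => c * h x); first exact: A_mul.
move=> x; rewrite -mulrBr normrM.
have := fh x; rewrite ltr_pdivlMr // => h1.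
by have := normr_ge0 (f x - h x); nra.
Qed.

Lemma uniform_closure_max f g : uniform_closure f -> uniform_closure g ->
  uniform_closure (fun x => Num.max (f x) (g x)).
Proof.
move=> Af Ag; under eq_fun do rewrite maxr_absE mulrC.
apply: uniform_closureZ; apply: uniform_closureD; first exact: uniform_closureD.
apply: uniform_closure_norm; apply: uniform_closureD => //.
by under eq_fun do rewrite -mulN1r; exact: uniform_closureZ.
Qed.

Lemma uniform_closure_min f g : uniform_closure f -> uniform_closure g ->
  uniform_closure (fun x => Num.min (f x) (g x)).
Proof.
move=> Af Ag.
have oppA h : uniform_closure h -> uniform_closure (fun x => - h x).
  by move=> Ah; under eq_fun do rewrite -mulN1r; exact: uniform_closureZ.
under eq_fun => x do rewrite -[Num.min _ _]opprK oppr_min.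
by apply: (oppA); apply: uniform_closure_max; exact: oppA.
Qed.

Lemma subset_uniform_closure : A `<=` uniform_closure.
Proof. by move=> f Af e e0; exists f => // x; rewrite subrr normr0. Qed.

Lemma two_point_interpolation (a b : X) (s t : R) : (a = b -> s = t) ->
  exists2 h, A h & h a = s /\ h b = t.
Proof.
move=> st; have [ab|ab] := pselect (a = b).
  by exists (fun=> s); [exact: A_cst|split=> //; exact: st].
have [f Af fab] := A_sep _ _ ab.
exists (fun x => s + (t - s) / (f b - f a) * (f x + - f a)).
  by apply: A_add => //; apply: A_mul => //; exact: A_add.
have fba : f b - f a != 0 by rewrite subr_eq0; apply/eqP => /esym.
by rewrite subrr mulr0 addr0 divfK // addrCA subrr addr0.
Qed.

Theorem stone_weierstrass f : continuous f -> uniform_closure f.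
Proof.
move=> cf.
have lt_near (h k : X -> R) x : continuous h -> continuous k -> h x < k x ->
    \forall y \near x, h y < k y.
  move=> ch ck hk.
  have : \forall y \near x, 0 < k y - h y.
    apply: (@cvgr_gt _ _ _ _ (fun y => k y - h y) (k x - h x)).
      by apply: cvgB; [exact: ck|exact: ch].
    by rewrite subr_gt0.
  by apply: filterS => y; rewrite subr_gt0.
have cfD (c : R) : continuous (fun x => f x + c).
  by move=> x; apply: cvgD; [exact: cf|exact: cvg_cst].
(* Near each [b], an interpolant of [f] at [a] and [b] exceeds [f - e]. A maximum of finitely many
   of these does so everywhere and keeps the value [f a] at [a]. Continuity is carried along because
   the next covering argument uses it. *)
have above a (e : R) : 0 < e -> exists h : X -> R,
    [/\ uniform_closure h, continuous h, h a = f a & forall b, f b + - e < h b].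
  move=> e0.
  pose P (N : set X) := exists h : X -> R,
    [/\ uniform_closure h, continuous h, h a = f a &
        forall b, N b -> f b + - e < h b].
  have [h [? ? ? h4]] : P setT; last by exists h; split=> // b; exact: h4.
  apply: (compact_ind X P) => //.
  - exists (fun=> f a); split=> //; first exact/subset_uniform_closure/A_cst.
    exact: cst_continuous.
  - move=> N1 N2 [h1 [h11 h12 h13 h14]] [h2 [h21 h22 h23 h24]].
    exists (fun x => Num.max (h1 x) (h2 x)); split.
    + exact: uniform_closure_max.
    + by move=> x; apply: continuous_max; [exact: h12|exact: h22].
    + by rewrite h13 h23 maxxx.
    + by move=> b [/h14|/h24]; rewrite lt_max => ->//; rewrite orbT.
  - move=> b; have [|h Ah [ha hb]] := two_point_interpolation a b (f a) (f b).
      by move=> ->.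
    have ch := A_continuous _ Ah.
    exists [set y | f y + - e < h y]; last first.
      by exists h; split=> //; exact: subset_uniform_closure.
    by apply: lt_near => //=; rewrite hb gtrDl oppr_lt0.
move=> e e0; have e20 := divr_gt0 e0 (@ltr0n R 2).
(* The function obtained from [above] at [a] lies below [f + e / 2] near [a]. Minima of finitely
   many such functions preserve the global lower bound. *)
pose P (N : set X) := exists h : X -> R, [/\ uniform_closure h,
  forall b, f b + - (e / 2) < h b & forall b, N b -> h b < f b + e / 2].
have [h [Ah h1 h2]] : P setT.
  apply: (compact_ind X P) => //.
  (* Even the empty set demands a function above [f - e / 2]: any point [a] provides one, and if [X]
     is empty the zero function works. *)
  - have [[a _]|X0] := pselect (exists x : X, True).
      by have [h [? ? _ ?]] := above a _ e20; exists h.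
    exists (fun=> 0); split=> //; first exact/subset_uniform_closure/A_cst.
    by move=> b; case: X0; exists b.
  - move=> N1 N2 [h1 [h11 h12 h13]] [h2 [h21 h22 h23]].
    exists (fun x => Num.min (h1 x) (h2 x)); split.
    + exact: uniform_closure_min.
    + by move=> b; rewrite lt_min h12 h22.
    + by move=> b [/h13|/h23]; rewrite gt_min => ->//; rewrite orbT.
  - move=> a; have [h [h1 h2 h3 h4]] := above a _ e20.
    exists [set y | h y < f y + e / 2]; last by exists h.
    by apply: lt_near => //=; rewrite h3 ltrDl.
have [k Ak hk] := Ah _ e20; exists k => // x.
rewrite [e]splitr -[f x](subrK (h x)) -addrA.
rewrite (le_lt_trans (ler_normD _ _)) // ltrD //.
rewrite ltr_norml; have := h1 x; have := h2 x I; lra.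
Qed.

End StoneWeierstrass.

(** This makes the compact sets [V] and [Kx] into compact spaces, to which Stone-Weierstrass
    applies. *)
Lemma compact_set_type (T : topologicalType) (V : set T) :
  compact V -> compact [set: V].
Proof.
move=> /compact_near_coveringP cV; apply/compact_near_coveringP => D F P FF h.
(* [Q] extends [P] to the ambient space, vacuously off [V]. Neighbourhoods in the subtype are traces
   of ambient ones, so near covering for [Q] yields it for [P]. *)
pose Q i x := forall Vx : x \in V, P i (exist _ x Vx).
suff : \near F, V `<=` Q F.
  by apply: filterS => i iQ [x Vx] _; exact: iQ (set_mem Vx) Vx.
apply: cV => x Vx.
have [[N1 N2] /= [[_ [[W oW <-] Wx] WN1] FN2] NP] :=
  h (exist _ x (mem_set Vx)) Logic.I.
exists (W, N2) => /=; first by split=> //; exact: open_nbhs_nbhs.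
move=> [y i] /= [Wy N2i] Vy.
by apply: (NP (exist _ y Vy, i)); split=> //=; exact: WN1.
Qed.

Lemma continuous_sum {R : realType} (T : topologicalType) (I : Type)
    (r : seq I) (F : I -> T -> R) : (forall i, continuous (F i)) ->
  continuous (fun x => \sum_(i <- r) F i x).
Proof.
by move=> cF; apply: continuous_big => //; exact: add_continuous.
Qed.

(** The final sums must have a positive number of terms, so an empty combination is replaced by a
    single term with coefficient zero. *)
Lemma tauber_wiener_nonempty {R : realType} {g : R -> R} (hg : TauberWiener g)
    (B delta : R) (f : R -> R) : 0 < B -> 0 < delta -> continuous f ->
  exists (J : finType) (a lambda theta : J -> R), (0 < #|J|)%N /\
  forall t, `|t| <= B ->
    `|f t - \sum_j a j * g (lambda j * t + theta j)| < delta.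
Proof.
move=> B0 d0 cf.
have [||m [a [l [th H]]]] := hg (- B) B _ f _ delta d0.
- by lra.
- exact: continuous_subspaceT.
case: m => [|m] in a l th H *; last first.
  exists 'I_m.+1, a, l, th; split; first by rewrite card_ord.
  by move=> t; rewrite ler_norml => /H.
exists unit, (fun=> 0), (fun=> 0), (fun=> 0); split; first by rewrite card_unit.
move=> t; rewrite ler_norml => /H; rewrite big_ord0 big1 // => j _.
by rewrite mul0r.
Qed.

(** * Density of sums of products, first with the exponential and then with [g] *)

Section ExponentialProducts.
Context {R : realType} {X : topologicalType} (cX : compact [set: X]).
Variables (LL MM : set (X -> R)).
Hypothesis LL_continuous : forall f, LL f -> continuous f.
Hypothesis MM_continuous : forall f, MM f -> continuous f.
Hypothesis LL0 : LL (fun=> 0).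
Hypothesis MM0 : MM (fun=> 0).
Hypothesis LL_add : forall f g, LL f -> LL g -> LL (fun x => f x + g x).
Hypothesis MM_add : forall f g, MM f -> MM g -> MM (fun x => f x + g x).
Hypothesis LLMM_sep : forall x y, x <> y ->
  exists2 f, LL f \/ MM f & f x <> f y.

Definition exp_span : set (X -> R) := [set h |
  exists (I : finType) (c : I -> R) (L M : I -> X -> R),
  [/\ (0 < #|I|)%N, forall i, LL (L i), forall i, MM (M i) &
      h = fun x => \sum_i c i * (expR (L i x) * expR (M i x))]].

Lemma exp_span1 (c : R) (L M : X -> R) : LL L -> MM M ->
  exp_span (fun x => c * (expR (L x) * expR (M x))).
Proof.
move=> LLL MMM; exists unit, (fun=> c), (fun=> L), (fun=> M); split=> //.
  by rewrite card_unit.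
by apply/funext => x; rewrite (big_pred1 tt) // => -[].
Qed.

(** Disjoint unions of index types give sums, and pairs of indices with added exponents give
    products. Injectivity of [expR] passes the separation of points from [LL] and [MM] to the
    span. *)
Lemma exp_span_dense (f : X -> R) : continuous f -> uniform_closure exp_span f.
Proof.
apply: stone_weierstrass => //.
- move=> _ [I [c [L [M [_ hL hM ->]]]]].
  apply: continuous_sum => i x; apply: cvgM; first exact: cvg_cst.
  have expC h : continuous h -> continuous (fun x : X => expR (h x)).
    move=> ch y; apply: (@continuous_comp _ _ _ h expR); first exact: ch.
    exact: continuous_expR.
  apply: cvgM; first exact: expC (LL_continuous _ (hL i)) x.
  exact: expC (MM_continuous _ (hM i)) x.
- move=> c; have := exp_span1 c _ _ LL0 MM0.
  by under eq_fun do rewrite expR0 !mulr1.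
- move=> _ _ [I [c [L [M [I0 hL hM ->]]]]] [I' [c' [L' [M' [_ hL' hM' ->]]]]].
  pose S (A : Type) (a : I -> A) (a' : I' -> A) k :=
    match k with inl i => a i | inr i => a' i end.
  exists (I + I')%type, (S _ c c'), (S _ L L'), (S _ M M'); split.
  + by rewrite card_sum ltn_addr.
  + by case.
  + by case.
  + by apply/funext => x; rewrite big_sumType.
- move=> _ _ [I [c [L [M [I0 hL hM ->]]]]] [I' [c' [L' [M' [I'0 hL' hM' ->]]]]].
  exists (I * I')%type, (fun k => c k.1 * c' k.2),
    (fun k x => L k.1 x + L' k.2 x), (fun k x => M k.1 x + M' k.2 x); split.
  + by rewrite card_prod muln_gt0 I0.
  + by move=> k; exact: LL_add.
  + by move=> k; exact: MM_add.
  + apply/funext => x; rewrite big_distrlr /= pair_bigA /=.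
    by apply: eq_bigr => k _; rewrite !expRD; ring.
- move=> x y /LLMM_sep[h [Lh|Mh] hxy].
  + have := exp_span1 1 _ _ Lh MM0.
    under eq_fun do rewrite expR0 mul1r mulr1.
    by move=> H; exists (expR \o h) => // /expR_inj.
  + have := exp_span1 1 _ _ LL0 Mh.
    under eq_fun do rewrite expR0 !mul1r.
    by move=> H; exists (expR \o h) => // /expR_inj.
Qed.

(** Expanding around the exact factors [a] and [b] requires bounds on these two only; the quadratic
    term is at most [delta] because [delta <= 1]. *)
Lemma mul_approx (a b a' b' P delta : R) :
  `|a| <= P -> `|b| <= P -> delta <= 1 -> `|a - a'| < delta ->
  `|b - b'| < delta -> `|a * b - a' * b'| <= delta * (2 * P + 1).
Proof.
move=> aP bP d1 aa' bb'.
have -> : a * b - a' * b' = (a - a') * b + a * (b - b') - (a - a') * (b - b').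
  by ring.
have -> : delta * (2 * P + 1) = delta * P + P * delta + delta * 1 by ring.
rewrite (le_trans (ler_normB _ _)) //.
rewrite lerD // ?(le_trans (ler_normD _ _)) // ?lerD // normrM ler_pM //.
- exact: ltW.
- exact: ltW.
- exact: ltW.
- by rewrite (le_trans (ltW bb')).
Qed.

Theorem ridge_product_dense (g : R -> R) (hg : TauberWiener g)
    (f : X -> R) (eps : R) : continuous f -> 0 < eps ->
  exists (I J : finType) (c : I -> R) (L M : I -> X -> R)
    (a lambda theta : J -> R),
  [/\ (0 < #|I|)%N, (0 < #|J|)%N, forall k, LL (L k), forall k, MM (M k) &
  forall x, `|f x - \sum_k c k *
    ((\sum_j a j * g (lambda j * L k x + theta j)) *
     (\sum_j a j * g (lambda j * M k x + theta j)))| < eps].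
Proof.
move=> cf e0; have e20 := divr_gt0 e0 (@ltr0n R 2).
have [_ [I [c [L [M [I0 hL hM ->]]]]] fh] := exp_span_dense f cf _ e20.
(* A bound common to all exponents lets one combination of [g], approximating [expR] on [[-B, B]],
   serve every factor. *)
have [B B0 [LB MB]] : exists2 B : R, 0 < B &
    (forall k x, `|L k x| <= B) /\ (forall k x, `|M k x| <= B).
  have bound (F : I -> X -> R) : (forall k, continuous (F k)) ->
      exists2 B : R, 0 < B & forall k x, `|F k x| <= B.
    move=> cF.
    have /choice[b hb] k : exists b : R, 0 < b /\ forall x, `|F k x| <= b.
      by have [b b0 hb] := compact_fun_bounded cX _ (cF k); exists b.
    exists (1 + \sum_k b k).
      by rewrite ltr_pwDl // sumr_ge0 // => k _; apply: ltW; have [] := hb k.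
    move=> k x; rewrite (le_trans ((hb k).2 x)) // (bigD1 k) //= addrCA lerDl.
    by rewrite addr_ge0 // sumr_ge0 // => i _; apply: ltW; have [] := hb i.
  have [B1 B10 h1] := bound L (fun k => LL_continuous _ (hL k)).
  have [B2 B20 h2] := bound M (fun k => MM_continuous _ (hM k)).
  exists (B1 + B2); first exact: addr_gt0.
  split=> k x; first by rewrite (le_trans (h1 k x)) // lerDl ltW.
  by rewrite (le_trans (h2 k x)) // lerDr ltW.
(* Each product is off by at most [delta * (2 * P + 1)], so the weighted sum is off by at most
   [delta * C]. The added 1 keeps [C] positive when all weights vanish. *)
pose P := expR B; pose C := (1 + \sum_k `|c k|) * (2 * P + 1).
have P0 : 0 < P := expR_gt0 B.
have C0 : 0 < C.
  apply: mulr_gt0; first by rewrite ltr_pwDl // sumr_ge0.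
  by rewrite addr_gt0 ?mulr_gt0.
pose delta := Num.min 1 (eps / 2 / C).
have d0 : 0 < delta by rewrite lt_min ltr01 divr_gt0.
have d1 : delta <= 1 by rewrite ge_min lexx.
have dC : delta * C <= eps / 2 by rewrite -ler_pdivlMr // ge_min lexx orbT.
have [J [a [l [th [J0 H]]]]] :=
  tauber_wiener_nonempty hg B delta expR B0 d0 (@continuous_expR R).
exists I, J, c, L, M, a, l, th; split=> // x.
have expP t : `|t| <= B -> `|expR t| <= P.
  by rewrite ler_norml => /andP[_ ?]; rewrite ger0_norm ?expR_ge0 ?ler_expR.
apply: le_lt_trans (ler_distD (\sum_k c k * (expR (L k x) * expR (M k x))) _ _) _.
rewrite [eps]splitr ltr_leD // -sumrB (le_trans _ dC) //.
rewrite (le_trans (ler_norm_sum _ _ _)) // /C mulrCA mulrDl mul1r mulr_suml.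
rewrite ler_wpDl // ?mulr_ge0 ?addr_ge0 ?mulr_ge0 //; try exact: ltW.
apply: ler_sum => k _; rewrite -mulrBr normrM ler_wpM2l //.
by apply: mul_approx => //; [exact: expP|exact: expP|exact: H|exact: H].
Qed.

End ExponentialProducts.

Lemma continuous_set_val (T : topologicalType) (V : set T) :
  continuous (val : V -> T).
Proof. exact: initial_continuous. Qed.

(** * Evaluation of continuous functions and of operators *)

Section Evaluation.
Context {R : realType} {T : topologicalType} {K : set T}.

Lemma Cspace_ext (f h : Cspace R K) : (forall x, f x = h x) -> f = h.
Proof. by move=> fh; apply/continuousEP => x; exact: fh. Qed.

Lemma continuous_Cspace_eval (x : K) : continuous (fun u : Cspace R K => u x).
Proof.
move=> u A /nbhs_ballP[e e0 eA]; apply/nbhs_ballP; exists e => // v.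
by move=> /Cspace_ballE uv; exact/eA/uv.
Qed.

(** Closeness of [G v] to [G u] is uniform in the second argument, so it combines with continuity of
    the single function [G u] at [x]. *)
Lemma continuous_operator_eval (S : topologicalType) (G : S -> Cspace R K) :
  continuous G -> continuous (fun p : S * K => G p.1 p.2).
Proof.
move=> cG [u x]; apply/cvgrPdist_lt => e e0 /=.
have e20 := divr_gt0 e0 (@ltr0n R 2).
have uN : nbhs u [set v | ball (G u) (e / 2) (G v)].
  by apply: cG; exact: nbhsx_ballx.
have xN : nbhs x [set y | `|G u x - G u y| < e / 2].
  by have /cvgrPdist_lt := @Cspace_continuous _ _ _ (G u) x; exact.
exists ([set v | ball (G u) (e / 2) (G v)], [set y | `|G u x - G u y| < e / 2]).
  by [].
move=> [v y] /= [/Cspace_ballE uv xy]; rewrite [e]splitr.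
by rewrite (le_lt_trans (ler_distD (G u y) _ _)) // ltrD.
Qed.

End Evaluation.

(** Functionals with different, possibly repeating, lists of points are rewritten over one common
    list: coefficients at repeated points add up, and absent points get coefficient zero. *)
Lemma sum_by_value (R : realType) (K : choiceType) (u : K -> R)
    (s : seq (R * K)) (ys : seq K) : uniq ys ->
  {subset [seq q.2 | q <- s] <= ys} ->
  \sum_(q <- s) q.1 * u q.2 =
  \sum_(y <- ys) (\sum_(q <- s | q.2 == y) q.1) * u y.
Proof.
move=> uys sys; under [RHS]eq_bigr do rewrite mulr_suml big_mkcond.
rewrite exchange_big; apply: eq_big_seq => q qs /=.
rewrite (bigD1_seq q.2) //=; last by apply: sys; exact: map_f.
rewrite eqxx big1 ?addr0 // => y; rewrite eq_sym => /negPf -> //.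
Qed.

Definition ridge {R : realType} (g : R -> R) n (b : 'rV[R]_n -> R) :=
  exists (w : 'rV[R]_n) (p : R), forall xi, b xi = g (dot w xi + p).

Lemma dotZ {R : realType} n (a : R) (w x : 'rV[R]_n) :
  dot (a *: w) x = a * dot w x.
Proof. by rewrite /dot mulr_sumr; apply: eq_bigr => j _; rewrite mxE mulrA. Qed.

(** * Approximation of a single operator *)

Section Operator.
Context {R : realType} {g : R -> R} (hg : TauberWiener g).
Context {T : topologicalType} {K : set T} (y0 : K).
Context {V : set (Cspace R K)} (cV : compact V).
Context {d : nat} {Kx : set 'rV[R]_d} (cKx : compact Kx).

Lemma operator_approximation (G : V -> Cspace R Kx) (eps : R) :
  continuous G -> 0 < eps ->
  exists (I J : finType) (N : nat) (c : I -> J -> R) (y : 'I_N.+1 -> K)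
    (b : I -> J -> 'rV[R]_N.+1 -> R) (tau : J -> 'rV[R]_d -> R),
  [/\ (0 < #|I|)%N, (0 < #|J|)%N, forall i k, ridge g _ (b i k),
      forall k, ridge g _ (tau k) &
  forall (u : V) (x : Kx), `|G u x - \sum_k \sum_i
     c i k * b i k (\row_j (val u : Cspace R K) (y j)) * tau k (val x)| < eps].
Proof.
move=> cG e0.
pose X : topologicalType := (V * Kx)%type.
have cX : compact [set: X].
  rewrite (_ : setT = [set: V] `*` [set: Kx]); last by apply/seteqP.
  by apply: compact_setX; exact: compact_set_type.
(* Lists of weighted points make the functionals closed under addition by concatenation. *)
pose lin (s : seq (R * K)) (p : X) : R :=
  \sum_(q <- s) q.1 * (val p.1 : Cspace R K) q.2.
pose LL := range lin.
pose MM := range (fun (w : 'rV[R]_d) (p : X) => dot w (val p.2)).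
have LLc f : LL f -> continuous f.
  move=> [s _ <-]; apply: continuous_sum => q p.
  apply: cvgM; first exact: cvg_cst.
  apply: (@continuous_comp X _ _ (val \o fst) (fun u : Cspace R K => u q.2)).
    apply: (@continuous_comp X _ _ fst val); first exact: cvg_fst.
    exact: continuous_set_val.
  exact: continuous_Cspace_eval.
have MMc f : MM f -> continuous f.
  move=> [w _ <-]; apply: continuous_sum => j p.
  apply: cvgM; first exact: cvg_cst.
  apply: (@continuous_comp X _ _ (val \o snd) (fun x : 'rV[R]_d => x 0 j)).
    apply: (@continuous_comp X _ _ snd val); first exact: cvg_snd.
    exact: continuous_set_val.
  exact: coord_continuous.
have [||||||I [J [c [L [M [a [l [th [I0 J0 hL hM H]]]]]]]]] :=
    ridge_product_dense cX LL MM LLc MMc _ _ _ _ _ g hg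
      (fun p => G p.1 p.2) eps _ e0.
- by exists [::] => //; apply/funext => p; rewrite /lin big_nil.
- exists 0 => //; apply/funext => p; rewrite /dot big1 // => j _.
  by rewrite mxE mul0r.
- move=> _ _ [s _ <-] [s' _ <-]; exists (s ++ s') => //.
  by apply/funext => p; rewrite /lin big_cat.
- move=> _ _ [w _ <-] [w' _ <-]; exists (w + w') => //.
  apply/funext => p; rewrite /dot -big_split; apply: eq_bigr => j _.
  by rewrite mxE mulrDl.
(* If [u = u'], some coordinate distinguishes [x] from [x']; otherwise evaluation at some point of
   [K] distinguishes [u] from [u']. *)
- move=> [u x] [u' x'] ux.
  have [uu|uu] := pselect (u = u').
    have xx : val x <> val x' by move=> /val_inj xx; apply: ux; rewrite uu xx.
    have [j xj] : exists j, val x 0 j <> val x' 0 j.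
      apply: contrapT => /forallNP h; apply: xx; apply/rowP => j.
      apply: contrapT; exact: h.
    exists (fun p : X => dot (delta_mx 0 j) (val p.2)).
      by right; exists (delta_mx 0 j).
    have dotj z : dot (delta_mx 0 j) z = z 0 j :> R.
      rewrite /dot (bigD1 j) //= mxE !eqxx mul1r big1 ?addr0 // => k kj.
      by rewrite mxE (negPf kj) andbF mul0r.
    by rewrite /= !dotj.
  have [y uy] : exists y, (val u : Cspace R K) y <> (val u' : Cspace R K) y.
    apply: contrapT => /forallNP h; apply: uu; apply: val_inj.
    apply: Cspace_ext => y; apply: contrapT; exact: h.
  exists (lin [:: (1, y)]); first by left; exists [:: (1, y)].
  by rewrite /lin !big_seq1 /= !mul1r.
- exact: continuous_operator_eval.
have /choice[s sL] k : exists s, L k = lin s by have [s _ <-] := hL k; exists s.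
have /choice[v vM] k : exists w, M k = fun p : X => dot w (val p.2).
  by have [w _ <-] := hM k; exists w.
(* All points sampled by any functional are collected, so that every inner function takes the same
   vector of samples. Adding [y0] keeps the list nonempty. *)
pose ys := undup (y0 :: flatten [seq [seq q.2 | q <- s k] | k <- enum I]).
have y0ys : y0 \in ys by rewrite mem_undup mem_head.
have ys0 : (0 < size ys)%N by case: (ys) y0ys.
pose N := (size ys).-1; have NE : N.+1 = size ys by rewrite prednK.
pose y (j : 'I_N.+1) := nth y0 ys j.
pose w k : 'rV[R]_N.+1 := \row_j \sum_(q <- s k | q.2 == y j) q.1.
have wE k (u : V) (x : Kx) :
    L k (u, x) = dot (w k) (\row_j (val u : Cspace R K) (y j)).
  rewrite sL /lin (sum_by_value _ _ _ _ ys) ?undup_uniq //.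
    by rewrite (big_nth y0) -NE big_mkord; apply: eq_bigr => j _; rewrite !mxE.
  move=> z zs; rewrite mem_undup inE; apply/orP; right.
  apply/flattenP; exists [seq q.2 | q <- s k] => //.
  by apply/mapP; exists k => //; rewrite mem_enum.
(* Multiplying out the two combinations of [g], the inner index is a term of the first, and the
   outer index pairs an exponential product with a term of the second. The dilations are absorbed
   into the weight vectors. *)
exists J, (I * J)%type, N, (fun i k => c k.1 * a i * a k.2), y,
  (fun i k xi => g (dot (l i *: w k.1) xi + th i)),
  (fun k x => g (dot (l k.2 *: v k.1) x + th k.2)); split=> //.
- by rewrite card_prod muln_gt0 I0.
- by move=> i k; exists (l i *: w k.1), (th i).
- by move=> k; exists (l k.2 *: v k.1), (th k.2).
move=> u x; have := H (u, x); congr (`|_ - _| < _).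
rewrite -(pair_bigA _ (fun k j => \sum_i c k * a i * a j *
  g (dot (l i *: w k) (\row_j0 (val u : Cspace R K) (y j0)) + th i) *
  g (dot (l j *: v k) (val x) + th j))) /=.
apply: eq_bigr => k _; rewrite big_distrlr /= mulr_sumr exchange_big.
apply: eq_bigr => j _; rewrite mulr_sumr; apply: eq_bigr => i _.
by rewrite !dotZ -(wE k u x) vM /=; ring.
Qed.

End Operator.

(** * Two operators with shared outer functions *)

Theorem theorem4p3 (R : realType) (g : R -> R) (hg : TauberWiener g)
  (K1' K2' : completeNormedModType R) (K1 : set K1') (K2 : set K2')
  (K1_neq0 : K1 !=set0) (K2_neq0 : K2 !=set0)
  (K1_compact : compact K1) (K2_compact : compact K2)
  (V1 : set (Cspace R K1)) (V2 : set (Cspace R K2))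
  (V1_compact : compact V1) (V2_compact : compact V2)
  (d : nat) (Kx : set 'rV[R]_d) (Kx_compact : compact Kx)
  (U : set (Cspace R Kx))
  (G1 : V1 -> U) (G2 : V2 -> U) (G : unionV V1 V2 -> U)
  (G1_cont : continuous G1) (G2_cont : continuous G2) (G_cont : continuous G)
  (GE1 : forall u1 : V1, G (inV1 V2 u1) = G1 u1)
  (GE2 : forall u2 : V2, G (inV2 V1 u2) = G2 u2)
  (UE : U = [set val (G1 u1) | u1 in [set: V1]] `|`
            [set val (G2 u2) | u2 in [set: V2]]) :
  forall eps : R, 0 < eps ->
  exists K I1 I2 N1 N2 : nat,
    [/\ (0 < K)%N, (0 < I1)%N, (0 < I2)%N, (0 < N1)%N & (0 < N2)%N] /\
  exists (c1 : 'I_I1 -> 'I_K -> R) (c2 : 'I_I2 -> 'I_K -> R)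
    (y : 'I_N1 -> K1) (z : 'I_N2 -> K2)
    (b1 : 'I_I1 -> 'I_K -> 'rV[R]_N1 -> R)
    (b2 : 'I_I2 -> 'I_K -> 'rV[R]_N2 -> R)
    (tau : 'I_K -> Kx -> R),
    [/\ forall i k, exists (w : 'rV[R]_N1) (p : R),
          forall xi, b1 i k xi = g (dot w xi + p),
        forall i k, exists (w : 'rV[R]_N2) (p : R),
          forall xi, b2 i k xi = g (dot w xi + p) &
        forall k, exists (w : 'rV[R]_d) (p : R),
          forall x, tau k x = g (dot w (val x) + p)] /\
    (forall (u1 : V1) (x : Kx),
      let hat1 : 'rV[R]_N1 := \row_j (val u1 : Cspace R K1) (y j) in
      `|(val (G1 u1) : Cspace R Kx) x -
          \sum_(k < K) \sum_(i < I1) c1 i k * b1 i k hat1 * tau k x| < eps) /\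
    (forall (u2 : V2) (x : Kx),
      let hat2 : 'rV[R]_N2 := \row_j (val u2 : Cspace R K2) (z j) in
      `|(val (G2 u2) : Cspace R Kx) x -
          \sum_(k < K) \sum_(i < I2) c2 i k * b2 i k hat2 * tau k x| < eps).
Proof.
move=> eps e0.
have cval (S : topologicalType) (H : S -> U) :
    continuous H -> continuous (val \o H : S -> Cspace R Kx).
  move=> cH s; apply: (@continuous_comp _ _ _ H val); first exact: cH.
  exact: continuous_set_val.
(* These points are the default samples, ensuring that each operator has at least one sampling
   point. *)
have [y1 K1y] := K1_neq0; have [y2 K2y] := K2_neq0.
have [I1 [J1 [N1 [c1 [y [b1 [t1 [I10 J10 rb1 rt1 H1]]]]]]]] :=
  operator_approximation hg (exist _ y1 (mem_set K1y)) V1_compact Kx_compact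
    _ eps (cval _ _ G1_cont) e0.
have [I2 [J2 [N2 [c2 [z [b2 [t2 [I20 J20 rb2 rt2 H2]]]]]]]] :=
  operator_approximation hg (exist _ y2 (mem_set K2y)) V2_compact Kx_compact
    _ eps (cval _ _ G2_cont) e0.
(* The two families of outer functions are concatenated; the weights of each
   operator vanish on the outer functions of the other. *)
pose J : finType := (J1 + J2)%type.
(* Padding terms have weight zero but must still be of ridge form; the constant [g 0] is, with zero
   weight vector and shift. *)
have ridge0 n : ridge g n (fun=> g 0).
  exists 0, 0 => xi; rewrite /dot big1 ?addr0 // => j _.
  by rewrite mxE mul0r.
pose C1 i (k : J) := if k is inl k1 then c1 i k1 else 0.
pose C2 i (k : J) := if k is inr k2 then c2 i k2 else 0.
pose B1 i (k : J) := if k is inl k1 then b1 i k1 else fun=> g 0.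
pose B2 i (k : J) := if k is inr k2 then b2 i k2 else fun=> g 0.
pose t (k : J) := match k with inl k1 => t1 k1 | inr k2 => t2 k2 end.
exists #|J|, #|I1|, #|I2|, N1.+1, N2.+1.
split; first by split=> //; rewrite card_sum ltn_addr.
exists (fun i k => C1 (enum_val i) (enum_val k)),
  (fun i k => C2 (enum_val i) (enum_val k)), y, z,
  (fun i k => B1 (enum_val i) (enum_val k)),
  (fun i k => B2 (enum_val i) (enum_val k)),
  (fun k x => t (enum_val k) (val x)).
split; first split.
- by move=> i k; case: (enum_val k) => j; [exact: rb1|exact: ridge0].
- by move=> i k; case: (enum_val k) => j; [exact: ridge0|exact: rb2].
- move=> k; have [w [p h]] : ridge g _ (t (enum_val k)).
    by case: (enum_val k) => j; [exact: rt1|exact: rt2].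
  by exists w, p => x; exact: h.
have sumE (I : finType) (F : I -> R) :
  \sum_(i < #|I|) F (enum_val i) = \sum_i F i.
  by rewrite -(big_enum_val (A := predT)).
(* Sums over ordinals return to sums over the index types, where the outer sum splits into the two
   families and the padded one vanishes. *)
have sumIJ (I : finType) (F : I -> J -> R) :
    \sum_(k < #|J|) \sum_(i < #|I|) F (enum_val i) (enum_val k) =
    \sum_k \sum_i F i (inl k) + \sum_k \sum_i F i (inr k).
  rewrite -(big_sumType _ predT (fun k => \sum_i F i k)) /= -[RHS]sumE.
  by apply: eq_bigr => k _; exact: (sumE _ (fun i => F i (enum_val k))).
split=> u x /=.
- rewrite (sumIJ _ (fun i k => C1 i k * B1 i k _ * t k (val x))).
  rewrite [X in _ - (_ + X)]big1 ?addr0; first exact: H1.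
  by move=> k _; rewrite big1 // => i _; rewrite !mul0r.
- rewrite (sumIJ _ (fun i k => C2 i k * B2 i k _ * t k (val x))).
  rewrite [X in _ - (X + _)]big1 ?add0r; first exact: H2.
  by move=> k _; rewrite big1 // => i _; rewrite !mul0r.
Qed.
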